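(* Let $(P_\alpha)_{\alpha\in A}$ be a net of probability measures on $(\mathcal{F},\mathcal{B}_F)$ and let $P$ be a probability measure on $(\mathcal{F},\mathcal{B}_F)$. If $P_\alpha \rightarrow_w P$ on $(\mathcal{F}, \tau_{F})$, then $P_\alpha \rightarrow_w P$ on $(\mathcal{F}, \tau_{uF})$.
   Context: $(E,\mathcal{G})$ is a non-empty locally compact, second-countable Hausdorff space; $\mathcal{G}$ is the family of its open sets, and $\mathcal{F}$ and $\mathcal{K}$ are the families of all closed and all compact subsets of $E$. For $A\subseteq E$ put $\mathcal{M}(A)=\{F\in\mathcal{F}: F\cap A=\emptyset\}$ and $\mathcal{H}(A)=\{F\in\mathcal{F}: F\cap A\neq\emptyset\}$. The Fell topology $\tau_F$ on $\mathcal{F}$ is generated by $\{\mathcal{M}(K):K\in\mathcal{K}\}\cup\{\mathcal{H}(G):G\in\mathcal{G}\}$; the upper Fell topology $\tau_{uF}$ on $\mathcal{F}$ is generated by $\{\mathcal{M}(K):K\in\mathcal{K}\}$. Their Borel $\sigma$-algebras coincide: $\mathcal{B}_F:=\sigma(\tau_F)=\sigma(\tau_{uF})$. Weak convergence: for a topological space $(X,\mathcal{O})$ and a net $(P_\alpha)_{\alpha\in A}$ ($A$ a directed set) of probability measures and a probability measure $P$ on $(X,\sigma(\mathcal{O}))$, $P_\alpha\rightarrow_w P$ on $(X,\mathcal{O})$ means convergence in the weak topology, i.e. the initial topology on the set of probability measures with respect to the maps $P\mapsto P(O)$, $O\in\mathcal{O}$, into $\mathbb{R}$ with the topology $\{(a,\infty):a\in\mathbb{R}\}\cup\{\emptyset,\mathbb{R}\}$.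 Equivalently: $\liminf_\alpha P_\alpha(O)\ge P(O)$ for all $O\in\mathcal{O}$; equivalently: $\limsup_\alpha P_\alpha(F)\le P(F)$ for all closed sets $F$ of $(X,\mathcal{O})$. *)

(* Defs.v *)
From HB Require Import structures.
From mathcomp Require Import all_boot all_order all_algebra finmap.
From mathcomp Require Import all_classical all_reals all_analysis.

Set Implicit Arguments.
Unset Strict Implicit.
Unset Printing Implicit Defensive.

Import Order.TTheory GRing.Theory Num.Theory.
Local Open Scope classical_set_scope.
Local Open Scope ring_scope.

Section closed_subsets.
Variable E : topologicalType.

Definition closed_set : Type := {F : set E | closed F}.

Definition misses (A : set E) : set closed_set :=
  [set F | sval F `&` A = set0].

Definition hits (A : set E) : set closed_set :=
  [set F | sval F `&` A !=set0].

End closed_subsets.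

(* The two topologies live on aliases of the same type [closed_set E]. *)
Definition fell (E : topologicalType) : Type := closed_set E.
Definition upper_fell (E : topologicalType) : Type := closed_set E.

Section fell_topologies.
Variable E : topologicalType.

Definition fell_subbase : set (set (closed_set E)) :=
  [set misses K | K in compact] `|` [set hits G | G in open].

Definition upper_fell_subbase : set (set (closed_set E)) :=
  [set misses K | K in compact].

HB.instance Definition _ := gen_eqMixin (fell E).
HB.instance Definition _ := gen_choiceMixin (fell E).
HB.instance Definition _ :=
  isPointed.Build (fell E) (exist _ set0 (@closed0 E)).
HB.instance Definition _ :=
  isSubBaseTopological.Build (fell E) fell_subbase id.

HB.instance Definition _ := gen_eqMixin (upper_fell E).
HB.instance Definition _ := gen_choiceMixin (upper_fell E).
HB.instance Definition _ :=
  isPointed.Build (upper_fell E) (exist _ set0 (@closed0 E)).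
HB.instance Definition _ :=
  isSubBaseTopological.Build (upper_fell E) upper_fell_subbase id.

Definition fell_open : set (set (closed_set E)) := @open (fell E).
Definition upper_fell_open : set (set (closed_set E)) := @open (upper_fell E).

End fell_topologies.

Arguments fell_open E : clear implicits.
Arguments upper_fell_open E : clear implicits.

Definition borel (X : ptopologicalType) := g_sigma_algebraType (@open X).

Section borel_fell.
Variable E : topologicalType.

Hypotheses (E0 : [set: E] !=set0) (hausE : hausdorff_space E).
Hypotheses (lcptE : locally_compact [set: E]) (scE : @second_countable E).

Let mu : set (set (closed_set E)) := @measurable _ (borel (upper_fell E)).

Let mu_bigcup (C : set (set (closed_set E))) : countable C ->
  C `<=` mu -> mu (\bigcup_(A in C) A).
Proof.
move=> cC Cmu; rewrite bigcup_set_type.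
apply: (@countable_bigcupT_measurable _ (borel (upper_fell E))).
  by rewrite (eq_countable (card_setT C)).
by move=> i; apply: Cmu; exact: set_valP.
Qed.

Let mu_misses K : compact K -> mu (misses K).
Proof.
move=> cK; apply: sub_sigma_algebra; exists [set misses K]; last first.
  by rewrite bigcup_set1.
by move=> _ ->; apply: finI_from1; exists K.
Qed.

Let countable_base : exists2 C : set (set E), countable C &
  (forall b, C b -> open b /\ compact (closure b)) /\
  forall x V, nbhs x V -> exists b, [/\ C b, b x & closure b `<=` V].
Proof.
have [B cB [oB nB]] := scE.
exists (B `&` [set b | compact (closure b)]).
  by apply: sub_countable cB; apply: subset_card_le => b [].
split=> [b [/oB ? ?]//|x V xV].
have [K] := @lcptE x I; rewrite withinET => xK [cK clK].
have [W xW WVK] := compact_regular hausE cK xK (filterI xV xK).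
have [b [Bb bx] bW] := nB _ _ xW.
exists b; split=> //; last by move=> y /(closureS bW) /WVK [].
split=> //; apply: (subclosed_compact (@closed_closure _ b) cK).
by move=> y /(closureS bW) /WVK [].
Qed.

Let open_fell_mu : (@open (fell E) : set (set (closed_set E))) `<=` mu.
Proof.
have [C cC [Cb nC]] := countable_base.
pose S := [set misses (closure b) | b in C] `|` [set hits b | b in C].
have cS : countable S.
  rewrite /S -bigcup2inE; apply: bigcup_countable => // i _.
  case: i => [|[|i]] /=; last exact: countable0.
  - exact: card_le_trans (card_image_le _ _) cC.
  - exact: card_le_trans (card_image_le _ _) cC.
have Smu : S `<=` mu.
  move=> _ [[b /Cb[_ cb] <-]|[b /Cb[ob _] <-]]; first exact: mu_misses.
  rewrite (_ : hits b = \bigcup_(A in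
      [set ~` misses (closure c) | c in C `&` [set c | closure c `<=` b]]) A).
    apply: mu_bigcup.
      apply: card_le_trans (card_image_le _ _) _.
      by apply: sub_countable cC; apply: subset_card_le => c [].
    move=> _ [c [/Cb[_ cc] _] <-].
    exact: (@measurableC _ (borel (upper_fell E)) _ (mu_misses cc)).
  apply/seteqP; split=> [F [x [Fx bx]]|F [_ [c [_ cb] <-]]].
    have [c [Cc cx cb]] := nC x b (open_nbhs_nbhs (conj ob bx)).
    exists (~` misses (closure c)); first by exists c.
    by apply/eqP/set0P; exists x; split=> //; exact: subset_closure.
  by move=> /eqP/set0P[x [Fx /cb bx]]; exists x.
pose S' := finI_from S id.
have S'mu : S' `<=` mu.
  move=> _ [N NS <-]; apply: (@fin_bigcap_measurable _ (borel (upper_fell E))).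
    exact: finite_fset.
  by move=> A /NS /set_mem /Smu.
move=> U [D' sD' <-].
rewrite (_ : \bigcup_(i in D') id i =
    \bigcup_(A in S' `&` [set A | A `<=` \bigcup_(i in D') id i]) A).
  apply: mu_bigcup; last by move=> A [/S'mu].
  have := @finI_from_countable _ _ _ id cS.
  by apply: sub_countable; apply: subset_card_le => A [].
apply/seteqP; split=> [F [V /[dup] D'V /sD' [N NS NV] VF]|F [A [_ AU] AF]]; last first.
  exact: AU.
pose G := filter_from (S' `&` [set A | A F]) id.
have filG : Filter G.
  apply: filter_from_filter.
    exists setT; split=> //; exists fset0 => //.
    by rewrite set_fset0 bigcap_set0.
  move=> A A' [SA AF] [SA' AF']; exists (A `&` A') => //; split=> //.
  exact: finI_fromI.
have GS A : S A -> A F -> G A.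
  by move=> SA AF; exists A => //; split=> //; exact: finI_from1.
suff [A [SA AF] AV] : G V.
  by exists A => //; split=> // y /AV Vy; exists V.
rewrite -NV; apply: filter_bigI => W NW.
have WF : W F by move: VF; rewrite -NV; apply.
move: NW => /NS /set_mem [[K cK WE] | [V0 oV0 WE]]; rewrite -{W}WE in WF *; last first.
  have [x [Fx Vx]] := WF.
  have [b [Cbb bx bV]] := nC x V0 (open_nbhs_nbhs (conj oV0 Vx)).
  apply: (@filterS _ _ _ (hits b)).
    move=> F' [y [F'y yb]]; exists y; split=> //.
    by apply: bV; exact: subset_closure.
  by apply: GS; [right; exists b|exists x].
have [x0 _] := E0.
pose pE : ptopologicalType := HB.pack (E : Type) (isPointed.Build E x0) (Topological.class E).
pose D := C `&` [set b | sval F `&` closure b = set0].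
have : @cover_compact pE K by rewrite -compact_cover.
move=> /(_ (set E) D id) [|x Kx|M MD KM].
- by move=> b [/Cb[]].
- have nFx : (~` sval F) x.
    by move=> Fx; have : (sval F `&` K) x by []; rewrite WF.
  have oF : open (~` sval F) by apply: closed_openC; exact: svalP F.
  have [b [Cbb bx bF]] := nC x _ (open_nbhs_nbhs (conj oF nFx)).
  exists b => //; split=> //; apply/seteqP; split=> // y [Fy /bF].
  exact.
apply: (@filterS _ _ _ (\bigcap_(b in [set` M]) misses (closure b))).
  move=> F' MF'; apply/seteqP; split=> // y [F'y /KM [b /= Mb yb]].
  have : (sval F' `&` closure b) y by split=> //; exact: subset_closure.
  by rewrite (MF' _ Mb).
apply: filter_bigI => b /MD /set_mem [Cbb Fb]; apply: GS => //.
by left; exists b.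
Qed.

(* The Fell and the upper Fell topologies generate the same sigma-algebra, so
   the probability measures on [borel (fell E)] are those on
   [borel (upper_fell E)]. *)
Lemma measurable_fellE :
  (@measurable _ (borel (fell E)) : set (set (closed_set E))) =
  @measurable _ (borel (upper_fell E)).
Proof.
apply/seteqP; split.
  apply: smallest_sub; last exact: open_fell_mu.
  exact: (@smallest_sigma_algebra (closed_set E) setT (@open (upper_fell E))).
apply: smallest_sub.
  exact: (@smallest_sigma_algebra (closed_set E) setT (@open (fell E))).
move=> U [D' sD' <-]; apply: sub_sigma_algebra; exists D' => // V /sD'.
move=> [N /= ND NV]; exists N => // x /ND.
by rewrite !inE => ?; left.
Qed.

End borel_fell.

Section ray_topology.
Variable R : realType.

Definition ray_open : set (set R) :=
  [set [set x | a < x] | a in [set: R]] `|` [set set0; setT].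

Lemma ray_openT : ray_open setT.
Proof. by right; right. Qed.

Lemma ray_openI : setI_closed ray_open.
Proof.
move=> _ _ [[a _ <-]|[->|->]] [[b _ <-]|[->|->]];
  rewrite ?setI0 ?set0I ?setIT ?setTI;
  try by [right; left|right; right|left; exists a|left; exists b].
by left; exists (Num.max a b) => //; apply/seteqP; split => x /=;
  rewrite gt_max => /andP.
Qed.

Lemma ray_open_bigU (I : Type) (f : I -> set R) :
  (forall i, ray_open (f i)) -> ray_open (\bigcup_i f i).
Proof.
move=> fo; set U := \bigcup_i f i.
have ray x : U x -> U = setT \/ exists2 a, a < x & [set y | a < y] `<=` U.
  move=> [i _]; have [[a _ fa]|[->//|fT _]] := fo i; last first.
    by left; apply/seteqP; split=> // y _; exists i; rewrite ?fT.
  by rewrite -fa => ax; right; exists a => // y ay; exists i; rewrite // -fa.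
have [U0|/set0P/negP/negPn/eqP ->] := pselect (U !=set0); last by right; left.
have [->|UT] := pselect (U = setT); first exact: ray_openT.
have up x y : U x -> x <= y -> U y.
  by move=> /ray[//|[a ax aU]] xy; apply: aU; exact: lt_le_trans xy.
have lbU : has_lbound U.
  apply: contrapT => nlb; apply: UT; apply/seteqP; split=> // y _.
  apply: contrapT => Uy; apply: nlb; exists y => x Ux.
  by rewrite leNgt; apply/negP => /ltW /(up _ _ Ux).
left; exists (inf U) => //; apply/seteqP; split => y /=.
  by move=> /(inf_lt U0)[x Ux /ltW]; exact: up.
move=> /ray[//|[a ay aU]]; rewrite (le_lt_trans _ ay)//.
by apply/ler_addgt0Pr => e e0; apply: ge_inf => //; apply: aU; rewrite /= ltrDl.
Qed.

End ray_topology.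

(* In this topology a net converges to [x] iff its limit inferior is at least
   [x]. *)
Definition ray_line (R : realType) : Type := R.

HB.instance Definition _ (R : realType) := Choice.on (ray_line R).
HB.instance Definition _ (R : realType) := @isOpenTopological.Build (ray_line R)
  (@ray_open R) (@ray_openT R) (@ray_openI R) (@ray_open_bigU R).

(* The initial topology for the maps [P |-> P U], [U] in [O], where [O] is the
   family of open sets of the topology considered on [T]. The members of [O]
   are meant to be measurable, so that [P U] is finite and [fine] is harmless. *)
Definition weak_probability d (T : measurableType d) (R : realType)
    (O : set (set T)) : Type :=
  sup_topology (fun U : {U : set T | O U} => Topological.class
    (initial_topology
      (fun P : probability T R => fine (P (sval U)) : ray_line R))).

HB.instance Definition _ d (T : measurableType d) (R : realType)
  (O : set (set T)) := Topological.on (weak_probability R O).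

Definition directed (A : Type) (le : A -> A -> Prop) : Prop :=
  [/\ [set: A] !=set0, (forall a, le a a),
      (forall a b c, le a b -> le b c -> le a c) &
      forall a b, exists2 c, le a c & le b c].

(* The filter of tails of a directed set, along which a net converges. *)
Definition tails (A : Type) (le : A -> A -> Prop) : set_system A :=
  filter_from [set: A] (fun a => [set b | le a b]).

Definition weak_cvg d (T : measurableType d) (R : realType) (A : Type)
    (le : A -> A -> Prop) (P_ : A -> probability T R) (P : probability T R)
    (O : set (set T)) : Prop :=
  (P_ : A -> weak_probability R O) @ tails le --> (P : weak_probability R O).

(* Main.v *)
Require Import Defs.
From mathcomp Require Import all_boot all_order all_algebra.
From mathcomp Require Import all_classical all_reals all_analysis.

Local Open Scope classical_set_scope.

(** The upper Fell topology is coarser than the Fell topology, because its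
    subbase consists of some of the subbasic sets of the latter
    ([upper_fell_open_sub]). The weak topology on probability measures is the
    initial one for the evaluations at the open sets, so a coarser topology on
    the underlying space gives fewer evaluations, and weak convergence for the
    finer topology implies weak convergence for the coarser one
    ([weak_cvg_sub]). *)

Lemma upper_fell_open_sub (E : topologicalType) :
  upper_fell_open E `<=` fell_open E.
Proof.
move=> U [D' sD' <-]; exists D' => // V /sD' [N ND NV]; exists N => // x /ND.
by rewrite !inE => Kx; left.
Qed.

Lemma tails_filter (A : Type) (le : A -> A -> Prop) :
  directed le -> Filter (tails le).
Proof.
move=> [[a _] _ le_trans le_ub]; apply: filter_from_filter; first by exists a.
move=> b c _ _; have [e be ce] := le_ub b c; exists e => // x ex.
by split; [exact: le_trans be ex | exact: le_trans ce ex].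
Qed.

Lemma weak_cvg_sub d (T : measurableType d) (R : realType) (A : Type)
    (le : A -> A -> Prop) (P_ : A -> probability T R) (P : probability T R)
    (O O' : set (set T)) : directed le -> O' `<=` O ->
  weak_cvg le P_ P O -> weak_cvg le P_ P O'.
Proof.
move=> dirA sO'O cvgP; have filA := tails_filter _ _ dirA.
apply/cvg_sup => -[U O'U].
by move/cvg_sup: cvgP => /(_ (exist _ U (sO'O _ O'U))).
Qed.

Theorem proposition3 (E : topologicalType) (R : realType)
  (E0 : [set: E] !=set0) (hausE : hausdorff_space E)
  (lcptE : locally_compact [set: E]) (scE : @second_countable E)
  (A : Type) (le : A -> A -> Prop) (dirA : directed le)
  (P_ : A -> probability (borel (fell E)) R) (P : probability (borel (fell E)) R) :
  weak_cvg le P_ P (fell_open E) -> weak_cvg le P_ P (upper_fell_open E).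
Proof. by apply: weak_cvg_sub dirA _; exact: upper_fell_open_sub. Qed.
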